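(* Let $n,r_1,\ldots,r_l\in\mathbb{Z}\setminus\{0\}$, with $n\geqslant 2$ if $n>0$. Then $$S(n;r_1,\ldots,r_l)=(-1)^{\kappa}\,\zeta\big((n,(r_1)\ast(r_2)\ast\cdots\ast(r_l))\big),$$ where $\kappa=\#\{i : r_i<0\}$. In particular, every $S(n;r_1,\ldots,r_l)$ is a $\mathbb{Z}$-linear combination of alternating Euler sums of weight $|n|+|r_1|+\cdots+|r_l|$ and depth at most $l+1$.
   Context: For integers $k,r\geqslant 1$ let $H_k^{(r)}=\sum_{j=1}^k j^{-r}$ and $\overline{H}_k^{(r)}=\sum_{j=1}^k (-1)^{j+1}j^{-r}$. For a nonzero integer $r$ put $X_k^{(r)}=H_k^{(r)}$ if $r>0$ and $X_k^{(r)}=\overline{H}_k^{(-r)}$ if $r<0$. For nonzero integers $n,r_1,\ldots,r_l$ (with $n\geqslant2$ if $n>0$) define the harmonic sum $S(n;r_1,\ldots,r_l)=\sum_{k=1}^\infty \frac{X_k^{(r_1)}\cdots X_k^{(r_l)}}{(k+1)^n}$ if $n>0$, and $S(n;r_1,\ldots,r_l)=\sum_{k=1}^\infty (-1)^{k+1}\frac{X_k^{(r_1)}\cdots X_k^{(r_l)}}{(k+1)^{|n|}}$ if $n<0$. Alternating Euler sums: for a finite sequence $(k_1,\ldots,k_d)$ of nonzero integers with $k_1\neq 1$, $\zeta(k_1,\ldots,k_d)=\sum_{m_1>\cdots>m_d>0}\prod_{i=1}^d \frac{\operatorname{sgn}(k_i)^{m_i}}{m_i^{|k_i|}}$; its weight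 is $\sum|k_i|$ and depth $d$. (The paper writes a negative entry $-k$ as $\bar k$.) Let $\mathscr{S}$ be the free abelian group generated by all finite sequences of nonzero integers, including the empty sequence denoted $1$. Concatenation $(\alpha,\beta)$ of sequences is extended bilinearly to $\mathscr{S}$, and for an integer $n$ and $\alpha\in\mathscr{S}$, $(n,\alpha)$ denotes the concatenation of the length-one sequence $(n)$ with $\alpha$. For $\alpha=\sum a_i\alpha_i$ set $\zeta(\alpha)=\sum a_i\zeta(\alpha_i)$. The harmonic product $\ast$ on $\mathscr{S}$ is the bilinear product defined recursively by $1\ast\alpha=\alpha\ast1=\alpha$ and $(k,\alpha)\ast(l,\beta)=(k,\alpha\ast(l,\beta))+(l,(k,\alpha)\ast\beta)+(p(k,l),\alpha\ast\beta)$ for nonzero integers $k,l$ and sequences $\alpha,\beta$, where $p(k,l)=\operatorname{sgn}(k)\operatorname{sgn}(l)(|k|+|l|)$. *)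

(* Defs.v *)
From mathcomp Require Import all_boot all_order all_algebra.
From mathcomp Require Import all_classical all_reals all_analysis.
From mathcomp Require Import freeg.

Set Implicit Arguments.
Unset Strict Implicit.
Unset Printing Implicit Defensive.

Import Order.TTheory GRing.Theory Num.Theory.
Import numFieldNormedType.Exports.

Local Open Scope ring_scope.

Definition nzint := {k : int | k != 0}.

Definition nzval (k : nzint) : int := val k.
Coercion nzval : nzint >-> int.

Definition harm (R : realType) (r k : nat) : R :=
  \sum_(1 <= j < k.+1) (j%:R ^+ r)^-1.

Definition alt_harm (R : realType) (r k : nat) : R :=
  \sum_(1 <= j < k.+1) (-1) ^+ j.+1 * (j%:R ^+ r)^-1.

Definition Xharm (R : realType) (r : nzint) (k : nat) : R :=
  if 0 < nzval r then harm R `|r|%N k else alt_harm R `|r|%N k.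

Definition Sterm (R : realType) (n : nzint) (rs : seq nzint) (k : nat) : R :=
  if 0 < nzval n then (\prod_(r <- rs) Xharm R r k) / k.+1%:R ^+ `|n|%N
  else (-1) ^+ k.+1 * (\prod_(r <- rs) Xharm R r k) / k.+1%:R ^+ `|n|%N.

Definition Spartial (R : realType) (n : nzint) (rs : seq nzint) (N : nat) : R :=
  \sum_(1 <= k < N.+1) Sterm R n rs k.

(* [limn] has a junk value on divergent sequences: convergence is a separate
   assertion [cvgn (Spartial R n rs)]. The same remark applies to [zeta]. *)
Definition Ssum (R : realType) (n : nzint) (rs : seq nzint) : R :=
  limn (Spartial R n rs).

Definition admissible (ks : seq nzint) : bool :=
  if ks is k :: _ then nzval k != 1 else true.

Definition weight (ks : seq nzint) : nat := (\sum_(k <- ks) `|nzval k|)%N.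

Definition depth (ks : seq nzint) : nat := size ks.

(* The part N >= m_1 > ... > m_d > 0 of the multiple sum. For k_1 = -1 the
   series is only conditionally convergent, and its value is the limit of these
   truncations, i.e. the outermost summation is over m_1 in increasing order. *)
Definition zeta_partial (R : realType) (ks : seq nzint) (N : nat) : R :=
  \sum_(ms : (size ks).-tuple 'I_N.+1 |
          sorted gtn (rcons [seq nat_of_ord m | m <- ms] 0%N))
    \prod_(km <- zip ks ms)
      ((sgz (nzval km.1))%:~R ^+ nat_of_ord km.2
        / (nat_of_ord km.2)%:R ^+ `|nzval km.1|%N).

Definition zeta (R : realType) (ks : seq nzint) : R :=
  limn (zeta_partial R ks).

Notation sgroup := {freeg (seq nzint) / int}.

Definition word (u : seq nzint) : sgroup := << u >>.

Definition bilin (f : seq nzint -> seq nzint -> sgroup) (a b : sgroup) : sgroup :=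
  fglift (fun u => fglift (f u) b) a.

Definition sconcat : sgroup -> sgroup -> sgroup :=
  bilin (fun u v => word (u ++ v)).

Definition scons (k : nzint) (a : sgroup) : sgroup := sconcat (word [:: k]) a.

Lemma pmerge_subproof (k l : nzint) :
  sgz (nzval k) * sgz (nzval l) * (`|nzval k| + `|nzval l|) != 0.
Proof.
have k0 : nzval k != 0 := valP k; have l0 : nzval l != 0 := valP l.
by rewrite !mulf_neq0 ?sgz_eq0 // paddr_eq0 // !normr_eq0 negb_and k0.
Qed.

Definition pmerge (k l : nzint) : nzint :=
  Sub (sgz (nzval k) * sgz (nzval l) * (`|nzval k| + `|nzval l|))
      (pmerge_subproof k l).

Fixpoint harmonic_word (u : seq nzint) : seq nzint -> sgroup :=
  match u with
  | [::] => word
  | k :: u' =>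
      fix harmonic_cons (v : seq nzint) : sgroup :=
        match v with
        | [::] => word (k :: u')
        | l :: v' =>
            scons k (harmonic_word u' (l :: v'))
            + scons l (harmonic_cons v')
            + scons (pmerge k l) (harmonic_word u' v')
        end
  end.

Lemma harmonic_word_cons (k l : nzint) (u v : seq nzint) :
  harmonic_word (k :: u) (l :: v) =
    scons k (harmonic_word u (l :: v))
    + scons l (harmonic_word (k :: u) v)
    + scons (pmerge k l) (harmonic_word u v).
Proof. by []. Qed.

Definition hproduct : sgroup -> sgroup -> sgroup := bilin harmonic_word.

(* (r_1) * (r_2) * ... * (r_l); the harmonic product is associative with unit
   the empty word, so the bracketing and the final unit are immaterial. *)
Definition harmonic_prod (rs : seq nzint) : sgroup :=
  \big[hproduct/word [::]]_(r <- rs) word [:: r].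

Definition zeta_lin (R : realType) (a : sgroup) : R :=
  \sum_(ks <- dom a) (coeff ks a)%:~R * zeta R ks.

(* Main.v *)
(** The truncations [Z_N(u)] of the alternating Euler sums, over
    [N >= m_1 > ... > m_d > 0], satisfy
    [Z_(N+1)(k,u) = Z_N(k,u) + sgn(k)^(N+1)/(N+1)^|k| Z_N(u)], so by induction
    [u -> Z_N(u)] turns the harmonic product into the ordinary product for every
    [N]. As [X_k^(r)] is [Z_k(r)] up to the sign of [r], the [N]-th partial sum of
    [S(n; r_1, ..., r_l)] is the signed value of [Z_(N+1)] at
    [(n, (r_1) * ... * (r_l))], and the identity follows by letting [N] grow.

    For convergence, [|Z_m(u)| <= H_m^d] with [d] the depth of [u], and
    [sum H_m^d / m^2] is finite; this settles [|n| >= 2]. For [n = -1] the terms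
    are [(-1)^m b_m] where [b_m = Z_(m-1)(u)/m] tends to [0] and
    [sum |b_(m+1) - b_m|] is finite by the same estimate. *)

Require Import Defs.
From mathcomp Require Import all_boot all_order all_algebra.
From mathcomp Require Import all_classical all_reals all_analysis.
From mathcomp Require Import freeg.
From mathcomp Require Import ring lra zify.

Set Implicit Arguments.
Unset Strict Implicit.
Unset Printing Implicit Defensive.

Import Order.TTheory GRing.Theory Num.Theory.
Import numFieldNormedType.Exports.

Local Open Scope classical_set_scope.
Local Open Scope ring_scope.

(** * Linear extension of functions to a free abelian group *)

Section FreegEval.
Variables (K : choiceType) (V : pzRingType).
Implicit Types (f : K -> V) (a b : {freeg K / int}).

(** The formula of [zeta_lin] with an arbitrary [f], so that the same calculus serves truncations
    and limits. *)
Definition fgeval f a : V := \sum_(k <- dom a) (coeff k a)%:~R * f k.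

(** Coefficients vanish off the support; elements with different supports can thus be compared over
    one common list. *)
Lemma fgevalE f a (s : seq K) : uniq s -> {subset dom a <= s} ->
  fgeval f a = \sum_(k <- s) (coeff k a)%:~R * f k.
Proof.
move=> us sas; rewrite (bigID (mem (dom a))) /= [X in _ + X]big1 ?addr0.
  rewrite -big_filter; apply: perm_big; apply: uniq_perm.
  - exact: uniq_dom.
  - exact: filter_uniq.
  - move=> x; rewrite mem_filter; apply/idP/andP => [xa|[]//].
    by split; last exact: sas.
by move=> x /coeff_outdom ->; rewrite mul0r.
Qed.

Lemma eq_fgeval f g a : f =1 g -> fgeval f a = fgeval g a.
Proof. by move=> fg; apply: eq_bigr => k _; rewrite fg. Qed.

Lemma fgevalD f a b : fgeval f (a + b) = fgeval f a + fgeval f b.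
Proof.
pose s := undup (dom a ++ dom b).
have us : uniq s by exact: undup_uniq.
rewrite !(@fgevalE f _ s) //.
- rewrite -big_split; apply: eq_bigr => k _.
  by rewrite coeffD rmorphD /= mulrDl.
- by move=> x xb; rewrite mem_undup mem_cat xb orbT.
- by move=> x xa; rewrite mem_undup mem_cat xa.
- by move=> x /domD_subset; rewrite mem_undup.
Qed.

Lemma fgeval0 f : fgeval f 0 = 0.
Proof. by rewrite /fgeval dom0 big_nil. Qed.

Lemma fgevalZ f (c : int) a : fgeval f (c *: a) = c%:~R * fgeval f a.
Proof.
rewrite (@fgevalE _ _ (dom a)) ?uniq_dom //; last exact: domZ_subset.
by rewrite mulr_sumr; apply: eq_bigr => k _; rewrite coeffZ rmorphM mulrA.
Qed.

Lemma fgevalU f k : fgeval f << k >> = f k.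
Proof. by rewrite /fgeval domU1 big_seq1 coeffU eqxx mulr1 mul1r. Qed.

End FreegEval.

Section FreegLift.
Variables (K L : choiceType).
Implicit Types (g : K -> {freeg L / int}) (a : {freeg K / int}).

Lemma fgliftE g a : fglift g a = \sum_(k <- dom a) coeff k a *: g k.
Proof. by rewrite -[in LHS](Freeg_dom a) fglift_Freeg /prelift big_map. Qed.

Lemma fgeval_fglift (V : pzRingType) (f : L -> V) g a :
  fgeval f (fglift g a) = fgeval (fun k => fgeval f (g k)) a.
Proof.
rewrite fgliftE [RHS]/fgeval.
elim: (dom a) => [|k s IHs]; first by rewrite !big_nil fgeval0.
by rewrite !big_cons fgevalD fgevalZ IHs.
Qed.

Lemma dom_fglift g a x : x \in dom (fglift g a) ->
  exists2 k, k \in dom a & x \in dom (g k).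
Proof.
rewrite fgliftE => /dom_sum_subset /flatten_mapP[k].
by rewrite filter_predT => ka /domZ_subset xk; exists k.
Qed.

End FreegLift.

(** * Weight and depth of the words in a harmonic product *)

Lemma sconsE (k : nzint) (a : sgroup) :
  scons k a = fglift (fun u => word (k :: u)) a.
Proof. by rewrite /scons /sconcat /bilin /word liftU scale1r. Qed.

Lemma dom_scons k a w : w \in dom (scons k a) ->
  exists2 u, u \in dom a & w = k :: u.
Proof.
rewrite sconsE => /dom_fglift[u ua]; rewrite domU1 inE => /eqP ->.
by exists u.
Qed.

Lemma fgeval_scons (V : pzRingType) (f : seq nzint -> V) k a :
  fgeval f (scons k a) = fgeval (fun u => f (k :: u)) a.
Proof.
by rewrite sconsE fgeval_fglift; apply: eq_fgeval => u; rewrite fgevalU.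
Qed.

Lemma abs_pmerge (k l : nzint) :
  `|nzval (pmerge k l)|%N = (`|nzval k| + `|nzval l|)%N.
Proof.
have k0 : nzval k != 0 := valP k; have l0 : nzval l != 0 := valP l.
have -> : nzval (pmerge k l) =
  sgz (nzval k) * sgz (nzval l) * (`|nzval k| + `|nzval l|) by [].
by rewrite !abszM -!sgrz !absz_sg k0 l0 !mul1n; lia.
Qed.

Lemma sgz_pmerge (k l : nzint) :
  sgz (nzval (pmerge k l)) = sgz (nzval k) * sgz (nzval l).
Proof.
have k0 : nzval k != 0 := valP k; have l0 : nzval l != 0 := valP l.
have -> : nzval (pmerge k l) =
  sgz (nzval k) * sgz (nzval l) * (`|nzval k| + `|nzval l|) by [].
rewrite !sgzM !sgz_id; set s := sgz (_ + _).
have -> : s = 1 by apply/eqP; rewrite /s sgz_cp0; lia.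
by rewrite mulr1.
Qed.

Lemma weight_cons k u : weight (k :: u) = (`|nzval k| + weight u)%N.
Proof. by rewrite /weight big_cons. Qed.

(** Merging two entries adds their absolute values and saves one place: the weight is kept, the
    depth can only drop. Cancellation between the three summands only shrinks the support, so
    inclusions of supports suffice. *)
Lemma dom_harmonic_word u v w : w \in dom (harmonic_word u v) ->
  weight w = (weight u + weight v)%N /\ (depth w <= depth u + depth v)%N.
Proof.
rewrite /depth; elim: u v w => [|k u IHu] v w.
  by rewrite domU1 inE => /eqP ->; rewrite {2}/weight big_nil.
elim: v w => [|l v IHv] w.
  by rewrite domU1 inE => /eqP ->; rewrite {3}/weight big_nil addn0 addn0.
rewrite harmonic_word_cons => /domD_subset; rewrite mem_cat => /orP[/domD_subset|].
  rewrite mem_cat => /orP[] /dom_scons[x].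
    by move=> /IHu[wx sx] ->; rewrite !weight_cons wx !weight_cons /= in sx *; lia.
  by move=> /IHv[wx sx] ->; rewrite !weight_cons wx !weight_cons /= in sx *; lia.
move=> /dom_scons[x /IHu[wx sx] ->].
by rewrite !weight_cons abs_pmerge wx /=; lia.
Qed.

Lemma dom_harmonic_prod rs w : w \in dom (harmonic_prod rs) ->
  weight w = (\sum_(r <- rs) `|nzval r|)%N /\ (depth w <= size rs)%N.
Proof.
rewrite /harmonic_prod; elim: rs w => [|r rs IHrs] w.
  by rewrite !big_nil domU1 inE => /eqP ->; rewrite /weight big_nil.
rewrite !big_cons {1}/hproduct /bilin /word liftU scale1r => /dom_fglift[v].
move=> /IHrs[wv sv] /dom_harmonic_word[ww sw]; rewrite ww wv.
rewrite {1}/weight big_seq1; split=> //.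
by move: sv sw; rewrite /depth /=; lia.
Qed.

(** * Truncated Euler sums and the harmonic product *)

Section Truncation.
Variable R : realType.

Definition sgn_pow (k : nzint) (m : nat) : R :=
  (sgz (nzval k))%:~R ^+ m / m%:R ^+ `|nzval k|%N.

(** The outermost index is [m.+1], so the remaining ones are at most [m]. This recursive form
    replaces the sum over tuples in every induction. *)
Fixpoint zeta_trunc (u : seq nzint) (N : nat) : R :=
  if u is k :: u' then \sum_(0 <= m < N) sgn_pow k m.+1 * zeta_trunc u' m else 1.

Lemma zeta_trunc_cons k u :
  zeta_trunc (k :: u) = series (fun m => sgn_pow k m.+1 * zeta_trunc u m).
Proof. by []. Qed.

Lemma zeta_trunc_consS k u N : zeta_trunc (k :: u) N.+1 =
  zeta_trunc (k :: u) N + sgn_pow k N.+1 * zeta_trunc u N.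
Proof. by rewrite /= big_nat_recr. Qed.

Lemma fgeval_zeta_trunc_cons k (a : sgroup) N :
  fgeval (fun u => zeta_trunc (k :: u) N) a =
  \sum_(0 <= m < N) sgn_pow k m.+1 * fgeval (zeta_trunc ^~ m) a.
Proof.
rewrite /fgeval /=; under eq_bigr do rewrite mulr_sumr.
rewrite exchange_big; apply: eq_bigr => m _.
by rewrite mulr_sumr; apply: eq_bigr => w _; rewrite mulrCA.
Qed.

(** The inner sums have a smaller bound but indices of the same type; separating the bound [M] from
    the type ['I_N.+1] lets the induction on [u] go through. *)
Lemma sum_tuple_path (u : seq nzint) (M N : nat) : (M <= N)%N ->
  \sum_(ms : (size u).-tuple 'I_N.+1 |
          path gtn M.+1 (rcons [seq nat_of_ord m | m <- ms] 0%N))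
    \prod_(km <- zip u ms) sgn_pow km.1 (nat_of_ord km.2) = zeta_trunc u M.
Proof.
elim: u M => [|k u IHu] M leMN /=.
  rewrite (big_pred1 [tuple]) /= ?big_nil // => t.
  by rewrite (tuple0 t); apply/esym/eqP.
rewrite (reindex (fun p : 'I_N.+1 * (size u).-tuple 'I_N.+1 =>
                    [tuple of p.1 :: p.2])) /=; last first.
  exists (fun t : (size u).+1.-tuple 'I_N.+1 => (thead t, [tuple of behead t])).
    by move=> [m t] _ /=; rewrite theadE; congr pair; apply: val_inj.
  by move=> t _; rewrite [RHS]tuple_eta; apply: val_inj.
under eq_bigr do rewrite big_cons.
rewrite -(pair_big_dep (fun m : 'I_N.+1 => (m < M.+1)%N)
  (fun (m : 'I_N.+1) (ms : (size u).-tuple 'I_N.+1) =>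
     path gtn m (rcons [seq nat_of_ord x | x <- ms] 0%N))
  (fun (m : 'I_N.+1) (ms : (size u).-tuple 'I_N.+1) => sgn_pow k m *
     \prod_(km <- zip u ms) sgn_pow km.1 (nat_of_ord km.2))) /=.
(* An outermost index 0 contributes nothing: no index lies strictly below it, not even the final
   0. *)
rewrite big_mkcond big_ord_recl /= [X in X + _]big1 ?add0r; last first.
  by move=> ms; case: (val ms).
rewrite big_mkord (big_ord_widen _ (fun m => sgn_pow k m.+1 * zeta_trunc u m) leMN).
rewrite -big_mkcond; apply: eq_big => m; first by rewrite /bump add1n ltnS.
rewrite /bump add1n ltnS => ltmM; rewrite -mulr_sumr IHu //; exact: ltnW.
Qed.

Lemma zeta_partialE u N : zeta_partial R u N = zeta_trunc u N.
Proof.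
rewrite -(sum_tuple_path u (leqnn N)); apply: eq_bigl => ms.
by case: (val ms) => [|m s] //=; rewrite ltn_ord.
Qed.

Lemma sgn_powM k l m : sgn_pow k m * sgn_pow l m = sgn_pow (pmerge k l) m.
Proof.
by rewrite /sgn_pow sgz_pmerge abs_pmerge rmorphM exprMn exprD invfM; ring.
Qed.

(** From N to N+1 the product (A + a)(B + b) gains aB + Ab + ab. These are the increments of the
    three summands of the recursion, the last one by [sgn_powM]. *)
Lemma fgeval_harmonic_word u v N :
  fgeval (zeta_trunc ^~ N) (harmonic_word u v) = zeta_trunc u N * zeta_trunc v N.
Proof.
elim: u v N => [|k u IHu] v N; first by rewrite fgevalU mul1r.
elim: v N => [|l v IHv] N; first by rewrite fgevalU mulr1.
rewrite harmonic_word_cons !fgevalD !fgeval_scons.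
rewrite !fgeval_zeta_trunc_cons; elim: N => [|N IHN]; first by rewrite /= !big_nil mul0r !addr0.
rewrite !big_nat_recr // !zeta_trunc_consS mulrDl !mulrDr -IHN.
by rewrite !IHu IHv -sgn_powM /=; ring.
Qed.

Lemma fgeval_harmonic_prod rs N :
  fgeval (zeta_trunc ^~ N) (harmonic_prod rs) =
  \prod_(r <- rs) zeta_trunc [:: r] N.
Proof.
rewrite /harmonic_prod; elim: rs => [|r rs IHrs]; first by rewrite !big_nil fgevalU.
rewrite !big_cons -IHrs {1}/hproduct /bilin /word liftU scale1r fgeval_fglift.
under eq_fgeval do rewrite fgeval_harmonic_word.
by rewrite /fgeval mulr_sumr; apply: eq_bigr => w _; rewrite mulrCA.
Qed.

Lemma Xharm_zeta_trunc (r : nzint) N :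
  Xharm R r N = (-1) ^+ (nzval r < 0)%R * zeta_trunc [:: r] N.
Proof.
have r0 : nzval r != 0 := valP r.
rewrite /Xharm /harm /alt_harm /zeta_trunc /sgn_pow big_add1 /=.
case: ltgtP r0 => // r0 _.
  by rewrite mul1r; apply: eq_bigr => j _; rewrite gtr0_sgz // expr1n mulr1 mul1r.
rewrite big_add1 mulr_sumr; apply: eq_bigr => j _.
by rewrite ltr0_sgz // mulr1 exprS mulrA.
Qed.

(** The factor (-1)^(k+1) present for negative [n] is the numerator of [sgn_pow n k.+1]; the only
    other signs come from the negative entries of [rs]. *)
Lemma Sterm_zeta_trunc (n : nzint) rs k : Sterm R n rs k =
  (-1) ^+ count (fun r => nzval r < 0)%R rs *
  (sgn_pow n k.+1 * fgeval (zeta_trunc ^~ k) (harmonic_prod rs)).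
Proof.
have n0 : nzval n != 0 := valP n.
have -> : (-1) ^+ count (fun r => nzval r < 0) rs *
    (sgn_pow n k.+1 * fgeval (zeta_trunc ^~ k) (harmonic_prod rs)) =
    sgn_pow n k.+1 * \prod_(r <- rs) Xharm R r k.
  rewrite fgeval_harmonic_prod mulrCA; congr (_ * _).
  elim: rs => [|r rs IHrs]; first by rewrite !big_nil mul1r.
  by rewrite !big_cons -IHrs Xharm_zeta_trunc /= exprD; ring.
rewrite /Sterm /sgn_pow; case: ltgtP n0 => // n0 _.
  by rewrite gtr0_sgz // expr1n; ring.
by rewrite ltr0_sgz //; ring.
Qed.

Lemma Spartial_zeta_trunc (n : nzint) rs N : (0 < size rs)%N ->
  Spartial R n rs N = (-1) ^+ count (fun r => nzval r < 0)%R rs *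
    fgeval (zeta_trunc ^~ N.+1) (scons n (harmonic_prod rs)).
Proof.
move=> rs0; have St0 : Sterm R n rs 0 = 0.
  rewrite Sterm_zeta_trunc fgeval_harmonic_prod.
  by case: rs rs0 => // r rs _; rewrite big_cons /= big_nil mul0r !mulr0.
(* As [rs] is nonempty, the term at k = 0 contains an empty harmonic sum and vanishes; adding it
   makes the ranges agree. *)
rewrite /Spartial -[LHS]add0r -{1}St0 -big_ltn // fgeval_scons.
rewrite fgeval_zeta_trunc_cons mulr_sumr.
by apply: eq_bigr => m _; rewrite Sterm_zeta_trunc.
Qed.

End Truncation.

(** * Powers of harmonic numbers and alternating series *)

Section Analysis.
Variable R : realType.

Lemma series_harmonic_ge0 N : 0 <= series (@harmonic R) N.
Proof. by apply: sumr_ge0 => i _; rewrite /harmonic invr_ge0. Qed.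

Lemma series_harmonic_leS N : series (@harmonic R) N <= series harmonic N.+1.
Proof. by rewrite seriesSr lerDl invr_ge0. Qed.

Lemma series_harmonic_powS l N : series (@harmonic R) N ^+ l <= series harmonic N.+1 ^+ l.
Proof. by rewrite lerXn2r ?nnegrE ?series_harmonic_ge0 // series_harmonic_leS. Qed.

(** A discrete mean value inequality: the cofactor of y - x has l+1 monomials, each at most y^l. *)
Lemma subrXX_le (x y : R) l : 0 <= x -> x <= y ->
  y ^+ l.+1 - x ^+ l.+1 <= l.+1%:R * (y - x) * y ^+ l.
Proof.
move=> x0 xy; have y0 := le_trans x0 xy.
rewrite subrXX -mulrA mulrCA ler_wpM2l ?subr_ge0 //.
rewrite mulr_natl -[X in _ *+ X]card_ord -sumr_const; apply: ler_sum => i _.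
have il : (i <= l)%N by rewrite -ltnS.
rewrite -[leRHS](_ : y ^+ (l - i) * y ^+ i = _); last by rewrite -exprD subnK.
by rewrite ler_wpM2l ?exprn_ge0 // lerXn2r.
Qed.

(** The common majorant; its denominator is chosen so that 1/((m+1)(m+2)) telescopes. *)
Definition harm_term l m : R := series harmonic m.+1 ^+ l / (m.+1 * m.+2)%:R.

Lemma harm_term_ge0 l m : 0 <= harm_term l m.
Proof. by rewrite divr_ge0 // exprn_ge0 // series_harmonic_ge0. Qed.

(* Summation by parts against [1/m - 1/(m+1)] lowers the power of the harmonic
   number by one. *)
Lemma harm_term_bound l : exists C : R, forall N,
  series (harm_term l) N + series harmonic N ^+ l / N.+1%:R <= C.
Proof.
elim: l => [|l [C IHl]].
  exists 1; elim=> [|N IHN]; first by rewrite seriesEnat /= big_nil add0r divr1.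
  apply: le_trans IHN; rewrite seriesSr /harm_term !expr0 -addrA lerD2l.
  rewrite natrM -(natr1 N.+1).
  have : (0 : R) < N.+1%:R by [].
  move: (N.+1%:R : R) => x x0.
  by rewrite [leLHS](_ : _ = 1 / x) //; field; lra.
(* The left side is at most 2(l+1) times [series (harm_term l) N], by induction on N. The factor l+1
   comes from [subrXX_le], the factor 2 from 1/x^2 <= 2/(x(x+1)) with x = N+1. *)
exists (2 * l.+1%:R * C) => N.
have C_le : series (harm_term l) N <= C.
  by apply: le_trans (IHl N); rewrite lerDl divr_ge0 // exprn_ge0 // series_harmonic_ge0.
apply: le_trans (ler_wpM2l _ C_le); last by rewrite mulr_ge0.
elim: N {C_le} => [|N IHN].
  by rewrite !seriesEnat /= !big_nil expr0n mul0r addr0 mulr0.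
rewrite !(seriesSr (harm_term _)) mulrDr -lerBlDr; apply: le_trans IHN.
rewrite -!addrA lerD2l /harm_term.
have := subrXX_le l (series_harmonic_ge0 N) (series_harmonic_leS N).
rewrite [X in _ * X * _](_ : _ = N.+1%:R^-1); last by rewrite seriesSr addrC addKr.
have := exprn_ge0 l (series_harmonic_ge0 N.+1).
rewrite natrM -(natr1 N.+1).
have : (1 : R) <= N.+1%:R by rewrite ler1n.
move: (N.+1%:R : R) => x x1.
move: (series harmonic N.+1 ^+ l) (series harmonic N.+1 ^+ l.+1)
  (series harmonic N ^+ l.+1) => a b c a0 abc.
(* The two terms in b combine by 1/(x(x+1)) + 1/(x+1) = 1/x. *)
rewrite [leLHS](_ : _ = b / x - 2 * l.+1%:R * a / (x * (x + 1))); last first.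
  by field; lra.
rewrite lerBlDr -lerBlDl -mulrBl.
apply: (@le_trans _ _ (l.+1%:R * x^-1 * a / x)).
  by rewrite ler_wpM2r // invr_ge0; lra.
rewrite -subr_ge0 [leRHS](_ : _ = l.+1%:R * a * (x - 1) / (x ^+ 2 * (x + 1))); last first.
  by field; lra.
by rewrite divr_ge0 // !mulr_ge0 //; lra || (rewrite exprn_ge0 //; lra).
Qed.

Lemma cvg_harm_term l : cvgn (series (harm_term l)).
Proof.
have [C bC] := harm_term_bound l.
apply: nondecreasing_is_cvgn.
  by apply: nondecreasing_series => m _ _; exact: harm_term_ge0.
exists C => _ [N _ <-]; apply: le_trans (bC N).
by rewrite lerDl divr_ge0 // exprn_ge0 // series_harmonic_ge0.
Qed.

(** The square of the sequence is H_N^(2l)/(N+1) times 1/(N+1), and [harm_term_bound] at exponent 2l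
    bounds the first factor. *)
Lemma cvg_series_harmonic_pow_div l :
  series harmonic N ^+ l / N.+1%:R @[N --> \oo] --> (0 : R).
Proof.
apply/norm_cvg0P.
have [C bC] := harm_term_bound (l.*2).
suff sq0 : (series harmonic N ^+ l / N.+1%:R) ^+ 2 @[N --> \oo] --> (0 : R).
  have := cvg_comp _ _ sq0 (@sqrt_continuous R 0).
  rewrite sqrtr0; apply: cvg_trans; apply: near_eq_cvg; near=> N.
  by rewrite /= sqrtr_sqr.
apply: (@squeeze_cvgr _ _ _ _ (fun=> 0) (fun N => C * harmonic N)).
- near=> N; rewrite sqr_ge0 /= expr2 mulrACA -exprD addnn mulrA ler_wpM2r ?invr_ge0 //.
  apply: le_trans (bC N); rewrite lerDr; apply: sumr_ge0 => m _; exact: harm_term_ge0.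
- exact: cvg_cst.
- by rewrite -[X in _ --> X](mulr0 C); apply: cvgMr; exact: cvg_harmonic.
Unshelve. all: by end_near. Qed.

(* Adding the series to its own shift turns it into a series of the differences. *)
Lemma cvg_alternating (b : R ^nat) : b @ \oo --> 0 ->
  cvgn (series (fun m => `|b m.+1 - b m|)) ->
  cvgn (series (fun m => (-1) ^+ m.+1 * b m)).
Proof.
move=> b0 cvb; pose T := series (fun m => (-1) ^+ m * (b m.+1 - b m)).
have cvT : cvgn T.
  apply: normed_cvg; rewrite (_ : [normed _] = series (fun m => `|b m.+1 - b m|)) //.
  by apply/funext => N; apply: eq_bigr => m _; rewrite /= normrM normrX normrN1 expr1n mul1r.
have -> : series (fun m => (-1) ^+ m.+1 * b m) =
    fun N => (T N - b 0%N + (-1) ^+ N * b N) / 2.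
  apply/funext; elim=> [|N IHN].
    by rewrite /T !seriesEnat /= !big_nil; field.
  by rewrite seriesSr IHN /T seriesSr !exprS; field.
apply: is_cvgMl; apply: is_cvgD; first by apply: is_cvgB => //; exact: is_cvg_cst.
have normb : (fun N => `|(-1) ^+ N * b N|) = (fun N => `|b N|).
  by apply/funext => N; rewrite normrM normrX normrN1 expr1n mul1r.
apply/cvg_ex; exists 0; apply: norm_cvg0; rewrite /= normb.
by apply/norm_cvg0P.
Qed.

End Analysis.

(** * Convergence of alternating Euler sums *)

Section Convergence.
Variable R : realType.

Lemma sgn_pow_le (k : nzint) p m : (p <= `|nzval k|)%N ->
  `|sgn_pow R k m.+1| <= m.+1%:R ^- p.
Proof.
move=> pk; rewrite /sgn_pow normrM normrX normfV normrX [`|m.+1%:R|]ger0_norm //.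
have k0 : nzval k != 0 := valP k.
apply: (@le_trans _ _ (m.+1%:R ^- `|nzval k|%N)); last first.
  rewrite lef_pV2 ?posrE ?exprn_gt0 //.
  by apply: ler_weXn2l => //; rewrite ler1n.
rewrite ler_piMl ?invr_ge0 ?exprn_ge0 // -intr_norm exprn_ile1 //.
by rewrite lerz1; case: sgzP k0.
Qed.

Lemma sgn_pow_le_harmonic (k : nzint) m : `|sgn_pow R k m.+1| <= harmonic m.
Proof.
by apply: (@sgn_pow_le k 1); rewrite absz_gt0; exact: (valP k).
Qed.

(** Inductively, with d the length of the tail, H_N^(d+1) + H_N^d/(N+1) = H_(N+1) H_N^d, which is at
    most H_(N+1)^(d+1). *)
Lemma zeta_trunc_le u N : `|zeta_trunc R u N| <= series harmonic N ^+ size u.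
Proof.
elim: u N => [|k u IHu] N /=; first by rewrite normr1.
elim: N => [|N IHN]; first by rewrite big_nil normr0 exprn_ge0 // series_harmonic_ge0.
rewrite big_nat_recr //; apply: le_trans (ler_normD _ _) _.
apply: (@le_trans _ _ (series harmonic N ^+ (size u).+1 +
                       harmonic N * series harmonic N ^+ size u)).
  apply: lerD => //; rewrite normrM; apply: ler_pM => //.
  exact: sgn_pow_le_harmonic.
by rewrite exprS -mulrDl -seriesSr exprS ler_wpM2l ?series_harmonic_ge0 // series_harmonic_powS.
Qed.

Lemma cvg_zeta_trunc_cons (n : nzint) u : nzval n != 1 ->
  cvgn (zeta_trunc R (n :: u)).
Proof.
move=> n1; have n0 : nzval n != 0 := valP n.
have [n2|] := leqP 2 `|nzval n|%N.
  rewrite zeta_trunc_cons; apply: (@normed_cvg R R^o).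
  (* The factor 2 absorbs (m+1)(m+2) <= 2(m+1)^2. *)
  apply: (@series_le_cvg _ _ (2 *: harm_term R (size u))) => [m|m|m|].
  - exact: normr_ge0.
  - by rewrite mulr_ge0 // harm_term_ge0.
  - rewrite [leLHS]normrM [leLHS]mulrC.
    apply: (@le_trans _ _ (series harmonic m.+1 ^+ size u * m.+1%:R ^- 2)).
      apply: ler_pM => //.
        exact: le_trans (zeta_trunc_le u m) (series_harmonic_powS R _ _).
      exact: sgn_pow_le.
    rewrite [leRHS](_ : _ = series harmonic m.+1 ^+ size u * (2 / (m.+1 * m.+2)%:R)).
      apply: ler_wpM2l; first by rewrite exprn_ge0 // series_harmonic_ge0.
      rewrite ler_pdivlMr // mulrC ler_pdivrMr ?exprn_gt0 //.
      by rewrite -natrX -natrM ler_nat; nia.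
    by rewrite mulrCA.
  - exact/is_cvg_seriesZ/cvg_harm_term.
move=> n2; have {n0 n1 n2} nN1 : nzval n = -1 by lia.
pose b m : R := zeta_trunc R u m / m.+1%:R.
rewrite zeta_trunc_cons (_ : (fun m => _) = fun m => (-1) ^+ m.+1 * b m); last first.
  by apply/funext => m; rewrite /sgn_pow nN1 mulrA mulrAC.
apply: cvg_alternating.
  apply: norm_cvg0; apply: (@squeeze_cvgr _ _ _ _ (fun=> 0)
    (fun m => series harmonic m ^+ size u / m.+1%:R)).
  - near=> m; rewrite normr_ge0 /= normrM normfV [`|m.+1%:R|]ger0_norm //.
    by rewrite ler_wpM2r ?invr_ge0 // zeta_trunc_le.
  - exact: cvg_cst.
  - exact: cvg_series_harmonic_pow_div.
(* The difference of b splits into the change of the truncation, whose increment involves only the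
   tail of [u] (hence [.-1]) and is 0 for empty [u], and the change of the denominator. *)
apply: (@series_le_cvg _ _ (harm_term R (size u).-1 + harm_term R (size u))) => [m|m|m|].
- exact: normr_ge0.
- by rewrite addr_ge0 // harm_term_ge0.
- have -> : b m.+1 - b m = (zeta_trunc R u m.+1 - zeta_trunc R u m) / m.+2%:R
      - zeta_trunc R u m / (m.+1 * m.+2)%:R.
    rewrite /b natrM -(natr1 m.+1); have : (0 : R) < m.+1%:R by [].
    by move: (m.+1%:R : R) => x x0; field; rewrite !lt0r_neq0 ?addr_gt0.
  apply: le_trans (ler_normB _ _) _; apply: lerD.
    case: u @b => [|k v] _; first by rewrite subrr mul0r normr0 harm_term_ge0.
    rewrite zeta_trunc_consS addrC addKr 2!normrM.
    rewrite /harm_term natrM invfM normfV [`|m.+2%:R|]ger0_norm // mulrA.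
    rewrite ler_wpM2r // mulrC ler_pM ?sgn_pow_le_harmonic //=.
    exact: le_trans (zeta_trunc_le v m) (series_harmonic_powS R _ _).
  rewrite normrM normfV [`|(_ * _)%:R|]ger0_norm // ler_wpM2r //.
  exact: le_trans (zeta_trunc_le u m) (series_harmonic_powS R _ _).
- exact/is_cvg_seriesD/cvg_harm_term/cvg_harm_term.
Unshelve. all: by end_near. Qed.

Lemma cvg_fgeval (K : choiceType) (F : K -> R ^nat) (l : K -> R)
    (a : {freeg K / int}) :
  (forall k, k \in dom a -> F k @ \oo --> l k) ->
  fgeval (F ^~ N) a @[N --> \oo] --> fgeval l a.
Proof.
rewrite /fgeval; elim: (dom a) => [|k s IHs] cvF.
  by under eq_fun do rewrite big_nil; rewrite big_nil; exact: cvg_cst.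
under eq_fun do rewrite big_cons; rewrite big_cons; apply: cvgD.
  by apply: cvgMr; apply: cvF; rewrite mem_head.
by apply: IHs => j js; apply: cvF; rewrite inE js orbT.
Qed.

End Convergence.

(** * Passage to the limit in the truncated identity *)

Theorem theorem2p1 (R : realType) (n : nzint) (rs : seq nzint)
    (hn : 0 < nzval n -> 2 <= nzval n) (hl : (0 < size rs)%N) :
  let a := scons n (harmonic_prod rs) in
  [/\ cvgn (Spartial R n rs),
      forall ks, ks \in dom a -> admissible ks /\ cvgn (zeta_partial R ks),
      Ssum R n rs = (-1) ^+ count (fun r => nzval r < 0) rs * zeta_lin R a
    & exists (m : nat) (c : 'I_m -> int) (ks : 'I_m -> seq nzint),
        (forall i, [/\ admissible (ks i),
                       cvgn (zeta_partial R (ks i)),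
                       weight (ks i) = (`|nzval n| + \sum_(r <- rs) `|nzval r|)%N
                     & (depth (ks i) <= (size rs).+1)%N])
        /\ Ssum R n rs = \sum_(i < m) (c i)%:~R * zeta R (ks i)].
Proof.
move=> a; set sg := (-1) ^+ _.
have n1 : nzval n != 1 by apply/eqP => n1; move: hn; rewrite n1 => /(_ isT).
have partialE u : zeta_partial R u = zeta_trunc R u.
  by apply/funext => N; exact: zeta_partialE.
have dom_a ks : ks \in dom a -> admissible ks /\ cvgn (zeta_partial R ks).
  move=> /dom_scons[u _ ->]; split; first exact: n1.
  by rewrite partialE; exact: cvg_zeta_trunc_cons.
(* Genuine convergence to the stated value gives both [cvgn] and the value of [limn], excluding its
   default value. *)
have cvS : Spartial R n rs @ \oo --> (sg * zeta_lin R a : R).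
  rewrite (_ : Spartial R n rs = fun N => sg * fgeval (zeta_trunc R ^~ N.+1) a); last first.
    by apply/funext => N; rewrite Spartial_zeta_trunc.
  apply: cvgMr; rewrite (cvg_shiftS (fun N => fgeval (zeta_trunc R ^~ N) a)).
  rewrite -/(fgeval (zeta R) a); apply: cvg_fgeval => ks /dom_a[_].
  by rewrite /zeta partialE.
have SsumE : Ssum R n rs = sg * zeta_lin R a by exact/cvg_lim.
split=> //; first by apply/cvg_ex; exists (sg * zeta_lin R a).
(* The words are those in the support of [a]; the global sign is absorbed into the integer
   coefficients. *)
exists (size (dom a)).
exists (fun i => (-1) ^+ count (fun r => nzval r < 0) rs * coeff (nth [::] (dom a) i) a).
exists (fun i => nth [::] (dom a) i); split=> [i|].
  have ai : nth [::] (dom a) i \in dom a by exact: mem_nth.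
  have [? ?] := dom_a _ ai; split=> //.
    have [u /dom_harmonic_prod[wu _] ->] := dom_scons ai.
    by rewrite weight_cons wu.
  by have [u /dom_harmonic_prod[_ ?] ->] := dom_scons ai.
rewrite SsumE /zeta_lin (big_nth [::]) big_mkord mulr_sumr.
by apply: eq_bigr => i _; rewrite rmorphM rmorphXn rmorphN1 mulrA.
Qed.
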